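(* There are absolute constants $c_1 > 0$ and $c_2 > 0$ such that $$c_1 \frac nk \leq \min_{P \in \mathcal{P}_{n,k}}\frac{\|P'\|_{[0,1]}}{V_0^1(P)} \leq \min_{P \in \mathcal{P}_{n,k}}\frac{\|P'\|_{[0,1]}}{|P(1)|} \leq c_2 \left( \frac nk + 1 \right)$$ for all integers $n \geq 1$ and $k \geq 1$. Here $c_1 = 1/12$ is a suitable choice.
   Context: For an integer $m \ge 0$, $\mathcal{P}_m$ denotes the set of all algebraic polynomials of degree at most $m$ with real coefficients. For integers $n,k \ge 1$, $\mathcal{P}_{n,k}$ is the set of all polynomials $P$ of degree at most $n+k$ with a zero at $0$ of order $n+1$, i.e. of the form $P(x) = x^{n+1}R(x)$ with $R \in \mathcal{P}_{k-1}$, $R$ not identically zero. For a real-valued function $f$ defined on a set $A \subset \mathbb{R}$, $\|f\|_A := \sup_{x \in A}|f(x)|$. For a continuously differentiable function $f$ on $[a,b]$, $V_a^b(f) := \int_a^b |f'(x)|\,dx$ is its total variation. A quotient with zero denominator $|P(1)| = 0$ (and nonzero numerator) is interpreted as $+\infty$. ''Absolute constants'' means that $c_1, c_2$ do not depend on $n$ or $k$. *)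

(* Defs.v *)
From HB Require Import structures.
From mathcomp Require Import all_boot all_order all_algebra.
From mathcomp Require Import all_classical all_reals all_analysis.
Set Implicit Arguments.
Unset Strict Implicit.
Unset Printing Implicit Defensive.
Import Order.TTheory GRing.Theory Num.Theory.
Import numFieldNormedType.Exports.
Local Open Scope classical_set_scope.
Local Open Scope ring_scope.

(** [size S <= k] means that [S] has degree at most [k - 1]. *)
Definition Pnk (R : realType) (n k : nat) : set {poly R} :=
  [set P | exists S : {poly R},
     [/\ S != 0, (size S <= k)%N & P = 'X^(n.+1) * S]].

Definition supnorm (R : realType) (A : set R) (f : R -> R) : \bar R :=
  ereal_sup [set `|f x|%:E | x in A].

(** [f^`()] is the two-sided derivative, also at the endpoints of [[a, b]];
    this does not affect the integral. *)
Definition C1_variation (R : realType) (a b : R) (f : R -> R) : \bar R :=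
  (\int[lebesgue_measure]_(x in `[a, b]) `|(f^`()%classic x)%:E|)%E.

(** The quotients below use the extended-real inverse, for which
    [0^-1 = +oo]: the quotient of a positive number by [0] is [+oo]. *)
Definition derivative_variation_ratio (R : realType) (P : {poly R}) : \bar R :=
  (supnorm `[0%R, 1%R] (horner P)^`()%classic / C1_variation 0 1 (horner P))%E.

Definition derivative_endpoint_ratio (R : realType) (P : {poly R}) : \bar R :=
  (supnorm `[0%R, 1%R] (horner P)^`()%classic / `|P.[1%R]|%:E)%E.

Definition is_min_over (R : realType) (T : Type) (A : set T) (F : T -> \bar R)
    (m : \bar R) : Prop :=
  (F @` A) m /\ lbound (F @` A) m.

(* Main.v *)
Require Import Defs.
From mathcomp Require Import all_boot all_order all_algebra.
From mathcomp Require Import all_classical all_reals all_analysis.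
From mathcomp Require Import measurable_realfun ring lra zify.
From mathcomp Require polyorder.
Set Implicit Arguments.
Unset Strict Implicit.
Import Order.TTheory GRing.Theory Num.Theory.
Import numFieldNormedType.Exports.
Local Open Scope ring_scope.

(** For [P] in the class, [P' = x^n Q] with [Q] of degree at most [m = k - 1].
Everything rests on where such a product can be large.

Lower bound.  If [|x^n Q| <= M] on [[0, 1]], then
[|x^n Q(x)| <= M exp (4 m - (2 n / 3) (1 - x))] there
([weighted_poly_decay]): apart from a layer of width about [6 m / n] at the
endpoint [1], [P'] decays exponentially, because a polynomial of low degree
grows too slowly outside the layer to compensate the decay of [x^n].  The
growth is controlled by Lagrange interpolation at [m + 1] equally spaced
nodes ([extrapolation_bound]).  Integrating the smaller of [M] and this
exponential ([integral_decay_bound]) gives [V(P) <= (12 k / n) ||P'||].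

Middle inequality.  [|P(1)|] is the modulus of the integral of [P'], since
[P(0) = 0], hence at most [V(P)].

Upper bound.  One wants [P'] as close to [1] as possible on a layer at the
endpoint.  With [N = n + k - 1], the polynomial
[sum_(n <= i <= N) C(N, i) x^i (1 - x)^(N - i)] is divisible by [x^n], is the
probability of at least [n] successes in [N] trials, so lies between [0] and
[1], and each of its [k] terms has integral [1 / (N + 1)].  Its primitive
[bernstein_ramp] therefore has [P(1) = k / (n + k)] and [||P'|| <= 1], so that
[c2 = 1] is suitable.

Existence of the minima.  [||P'||], [V(P)] and [|P(1)|] are seminorms on a
finite-dimensional space, the first one definite on it; the quotient of a
seminorm by a norm attains its maximum, on the unit sphere
([seminorm_quotient_max]).  The reciprocal quotient attains its minimum at the
same place as soon as that maximum is positive, which [bernstein_ramp]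
shows. *)

(** * Growth of a polynomial outside equally spaced nodes *)

(** The denominators of the Lagrange basis at the nodes [0, ..., m]. *)
Lemma prod_dist_ord (R : realDomainType) (m : nat) (j : 'I_m.+1) :
  \prod_(i < m.+1 | i != j :> nat) `|j%:R - i%:R| = (j`! * (m - j)`!)%:R :> R.
Proof.
have jm : (j <= m)%N by rewrite -ltnS.
rewrite -(big_mkord (fun i => i != j) (fun i => `|j%:R - i%:R : R|)).
rewrite (@big_cat_nat _ _ _ j)//=; last exact: leqW.
rewrite [X in _ * X]big_ltn_cond// eqxx /= natrM; congr (_ * _).
  rewrite -ffactnn ffact_prod natr_prod -(big_mkord xpredT (fun i => (j - i)%:R)).
  rewrite big_nat_cond [RHS]big_nat_cond; apply: eq_big => [i|i].
    by case: ltngtP; rewrite ?andbF.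
  by move=> /andP[/andP[_ ij] _]; rewrite natrB 1?ltnW// ger0_norm// subr_ge0 ler_nat ltnW.
rewrite fact_prod natr_prod -{1}[j.+1]add1n big_addn subSn// -[in RHS](addn0 1%N) addn0.
rewrite big_nat_cond [RHS]big_nat_cond; apply: eq_big => [i|i].
  by case: (ltnP 0 i) => //= i0; rewrite (_ : (_ + _ != _)%N = true) ?andbT//; lia.
move=> /andP[/andP[i0 _] _]; rewrite natrD distrC addrK.
by rewrite ger0_norm.
Qed.

Lemma expR_ge_pow_fact (R : realType) (x : R) (m : nat) :
  0 <= x -> x ^+ m / m`!%:R <= expR x.
Proof.
move=> x0; case: m => [|m].
  by rewrite expr0 fact0 divr1 -{1}expR0 ler_expR.
by apply: le_trans (expR_ge1Dxn m x0); rewrite lerDr.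
Qed.

(** At [a - h w] the basis polynomial of the node [a + h j] is at most
[(w + m)^m / (j! (m - j)!) = C(m, j) (w + m)^m / m!], and
[(w + m)^m / m! <= exp (w + m)]; the binomial coefficients add up to
[2^m <= exp m]. *)
Lemma extrapolation_bound (R : realType) (m : nat) (Q : {poly R}) (a h w M : R) :
  0 < h -> 0 <= w -> (size Q <= m.+1)%N ->
  (forall j, (j <= m)%N -> `|Q.[a + h * j%:R]| <= M) ->
  `|Q.[a - h * w]| <= M * expR (w + 2 * m%:R).
Proof.
move=> h0 w0 sQ QM.
have M0 : 0 <= M by apply: le_trans (QM 0%N _).
pose x (i : nat) := a + h * i%:R.
have x_inj : injective x.
  by move=> i j /addrI/(mulfI (lt0r_neq0 h0))/eqP; rewrite eqr_nat => /eqP.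
rewrite [in leLHS](lagrange_gen (ltn0Sn m) x_inj sQ) horner_sum.
apply: le_trans (ler_norm_sum _ _ _) _.
have bound (j : 'I_m.+1) : `|(Q.[x j]%:P * tnth (lagrange m.+1 x) j).[a - h * w]|
   <= M * ('C(m, j)%:R * expR (w + m%:R)).
  have jm : (j <= m)%N by rewrite -ltnS.
  rewrite hornerM hornerC normrM ler_pM ?normr_ge0 ?QM//.
  rewrite (lagrangeE (ltn0Sn m) x_inj) hornerM hornerC.
  rewrite !horner_prod normrM normfV !normr_prod.
  have -> : \prod_(i < m.+1 | i != j :> nat) `|('X - (x i)%:P).[x j]| =
      h ^+ m * (j`! * (m - j)`!)%:R.
    rewrite -prod_dist_ord (eq_bigr (fun i : 'I_m.+1 => h * `|j%:R - i%:R|)).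
      by rewrite big_split/= prodr_const cardC1 card_ord.
    move=> i _; rewrite hornerXsubC /x.
    by rewrite opprD addrACA subrr add0r -mulrBr normrM gtr0_norm.
  have le_w : \prod_(i < m.+1 | i != j :> nat) `|('X - (x i)%:P).[a - h * w]| <=
      h ^+ m * (w + m%:R) ^+ m.
    rewrite -exprMn.
    have -> : (h * (w + m%:R)) ^+ m = \prod_(i < m.+1 | i != j :> nat) (h * (w + m%:R)).
      by rewrite prodr_const cardC1 card_ord.
    apply: ler_prod => i _; rewrite normr_ge0/= hornerXsubC /x.
    rewrite opprD addrACA subrr add0r -opprD -mulrDr normrN normrM gtr0_norm//.
    rewrite ler_pM2l// ger0_norm ?addr_ge0// lerD2l ler_nat -ltnS//.
  apply: le_trans (ler_wpM2l _ le_w) _.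
    by rewrite invr_ge0 mulr_ge0// exprn_ge0// ltW.
  have F0 : (0 < (j`! * (m - j)`!)%:R :> R) by rewrite ltr0n muln_gt0 !fact_gt0.
  have -> : (h ^+ m * (j`! * (m - j)`!)%:R)^-1 * (h ^+ m * (w + m%:R) ^+ m) =
     'C(m, j)%:R * ((w + m%:R) ^+ m / m`!%:R).
    rewrite -(bin_fact jm) [in RHS]natrM.
    have C0 : (0 < 'C(m, j)%:R :> R) by rewrite ltr0n bin_gt0.
    by field; rewrite ?lt0r_neq0// exprn_gt0.
  by rewrite ler_wpM2l// expR_ge_pow_fact// addr_ge0.
apply: le_trans (ler_sum _ (fun j _ => bound j)) _.
rewrite -big_distrr -big_distrl/= ler_wpM2l//.
have -> : \sum_(i < m.+1) 'C(m, i)%:R = 2 ^+ m :> R.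
  rewrite -natrX; transitivity (((1 + 1) ^ m)%N%:R : R); last by rewrite addn1.
  rewrite expnDn natr_sum; apply: eq_bigr => i _.
  by rewrite !exp1n !muln1.
rewrite (_ : w + 2 * m%:R = m%:R * 1 + (w + m%:R)); last by ring.
rewrite (expRD (m%:R * 1)) expRM_natl ler_wpM2r ?expR_ge0//.
by rewrite lerXn2r ?nnegrE ?expR_ge0// (le_trans _ (expR_ge1Dx _)).
Qed.

(** Extrapolation from the nodes [a + h j], where [h = 3 / n] and
[a = 1 - h m], so that the last node is [1].  At [x = a - h w] the factor
[(x / a)^n] is at most [exp (- n h w) = exp (- 3 w)] and beats the growth
[exp (w + 2 m)] of [Q]; the exponent [2 m - 2 w] is the one stated. *)
Lemma weighted_poly_decay (R : realType) (n m : nat) (Q : {poly R}) (M : R) :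
  (0 < n)%N -> (size Q <= m.+1)%N ->
  (forall x, 0 <= x <= 1 -> `|x ^+ n * Q.[x]| <= M) ->
  forall x, 0 <= x <= 1 ->
    `|x ^+ n * Q.[x]| <= M * expR (4 * m%:R - 2 * n%:R / 3 * (1 - x)).
Proof.
move=> n0 sQ QM x x01; have /andP[x0 x1] := x01.
have N0 : (0 < n%:R :> R) by rewrite ltr0n.
have M0 : 0 <= M by apply: le_trans (QM x x01).
pose h : R := 3 / n%:R.
have h0 : 0 < h by rewrite divr_gt0.
have nh : n%:R * h = 3 by rewrite /h; field; rewrite lt0r_neq0.
have m0 : 0 <= m%:R :> R by [].
pose a := 1 - h * m%:R.
(* between the nodes the exponent is at least [2 m], so the bound is trivial *)
have [xa|ax] := ltP x a; last first.
  apply: le_trans (QM x x01) _; rewrite ler_peMr// -{1}expR0 ler_expR.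
  have : n%:R * (1 - x) <= 3 * m%:R.
    rewrite -nh -mulrA ler_wpM2l ?(ltW N0)//; rewrite /a in ax; lra.
  lra.
have a1 : a <= 1 by rewrite gerBl mulr_ge0// ltW.
have a0 : 0 < a by lra.
pose w := (a - x) / h.
have hw : h * w = a - x by rewrite /w; field; rewrite lt0r_neq0.
have w0 : 0 <= w by rewrite divr_ge0 ?subr_ge0 ?ltW.
(* [|Q| <= M y^(-n) <= M a^(-n)] at each node [y] *)
have step : `|Q.[a - h * w]| <= M / a ^+ n * expR (w + 2 * m%:R).
  apply: extrapolation_bound => // j jm.
  have aj : a <= a + h * j%:R by rewrite lerDl mulr_ge0// ltW.
  have j1 : a + h * j%:R <= 1.
    by rewrite /a -addrA gerDl addrC subr_le0 ler_wpM2l ?(ltW h0)// ler_nat.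
  rewrite ler_pdivlMr ?exprn_gt0//.
  apply: le_trans (QM (a + h * j%:R) _); last by rewrite j1 andbT (le_trans (ltW a0)).
  rewrite normrM mulrC ler_wpM2r// ger0_norm ?exprn_ge0 ?(le_trans (ltW a0))//.
  by rewrite lerXn2r// ?nnegrE ?(le_trans (ltW a0))// ltW.
rewrite hw opprB addrC subrK in step.
rewrite normrM ger0_norm ?exprn_ge0//.
apply: le_trans (ler_wpM2l _ step) _; first exact: exprn_ge0.
have xan : x ^+ n / a ^+ n <= expR (- (3 * w)).
  rewrite -expr_div_n (_ : - (3 * w) = n%:R * (x - a)).
    rewrite expRM_natl lerXn2r ?nnegrE ?expR_ge0 ?divr_ge0 ?(ltW a0)//.
    apply: le_trans (expR_ge1Dx _).
    rewrite ler_pdivrMr// -subr_ge0.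
    have -> : (1 + (x - a)) * a - x = (a - x) * (1 - a) by ring.
    by rewrite mulr_ge0// subr_ge0// ltW.
  by rewrite -nh -mulrA hw; ring.
have -> : x ^+ n * (M / a ^+ n * expR (w + 2 * m%:R)) =
    M * (x ^+ n / a ^+ n * expR (w + 2 * m%:R)) by ring.
rewrite ler_wpM2l//; apply: le_trans (ler_wpM2r (expR_ge0 _) xan) _.
rewrite -expRD ler_expR.
have : 3 * w = n%:R * (1 - x) - 3 * m%:R.
  by rewrite -{1}nh -mulrA hw /a -nh; ring.
lra.
Qed.

(** * Integral of a function with an exponential majorant *)

Lemma integral_derivative (R : realType) (F f : R -> R) (a b : R) :
  a < b -> (forall x : R, is_derive x (1 : R) F (f x)) -> continuous f ->
  (\int[lebesgue_measure]_(x in `[a, b]) (f x)%:E = (F b - F a)%:E)%E.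
Proof.
move=> ab dF cf.
have cF x : {for x, continuous F}.
  by apply: differentiable_continuous; apply/derivable1_diffP; have [] := dF x.
rewrite EFinB; apply: continuous_FTC2 => //.
- exact: continuous_subspaceT.
- split => [x _||]; first by have [] := dF x.
  + exact: cvg_at_right_filter (cF a).
  + exact: cvg_at_left_filter (cF b).
- by move=> x _; rewrite derive1E; have [_ ->] := dF x.
Qed.

Lemma integral_le_primitive (R : realType) (F f g : R -> R) (a b : R) :
  a < b -> (forall x : R, is_derive x (1 : R) F (f x)) -> continuous f -> continuous g ->
  (forall x, a <= x <= b -> 0 <= g x <= f x) ->
  (\int[lebesgue_measure]_(x in `[a, b]) (g x)%:E <= (F b - F a)%:E)%E.
Proof.
move=> ab dF cf cg gf; rewrite -(integral_derivative ab dF cf).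
apply: ge0_le_integral => //.
- by move=> x /=; rewrite in_itv/= => /gf/andP[]; rewrite lee_fin.
- by apply/measurable_EFinP/measurable_funTS; exact: continuous_measurable_fun.
- by apply/measurable_EFinP/measurable_funTS; exact: continuous_measurable_fun.
- by move=> x /=; rewrite in_itv/= => /gf/andP[_]; rewrite lee_fin.
Qed.

(** With [z = c - alpha (1 - x)] the hypotheses give
[f <= M min (1, e^z) <= 2 M e^z / (1 + e^z)], and this smooth majorant has the
primitive [(2 M / alpha) ln (1 + e^z)]. *)
Lemma integral_decay_bound (R : realType) (f : R -> R) (M alpha c : R) :
  0 < alpha -> 0 <= c -> 0 <= M -> continuous f ->
  (forall x, 0 <= x <= 1 ->
     0 <= f x <= M /\ f x <= M * expR (c - alpha * (1 - x))) ->
  (\int[lebesgue_measure]_(x in `[0%R, 1%R]) (f x)%:E <=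
   (2 * M / alpha * (c + 1))%:E)%E.
Proof.
move=> a0 c0 M0 cf fM.
pose e x := expR (c - alpha * (1 - x)).
have e0 x : 0 < e x by exact: expR_gt0.
have e1 x : 0 < 1 + e x by rewrite addr_gt0.
pose F x := 2 * M / alpha * ln (1 + e x).
pose g x := 2 * M * (e x / (1 + e x)).
have de (x : R) : is_derive x (1 : R) e (alpha * e x).
  rewrite mulrC; apply: (@is_derive1_comp R expR (fun x => c - alpha * (1 - x))).
  rewrite (_ : (fun _ => _) = cst c - alpha *: (cst 1 - id))//.
  by apply: is_derive_eq; rewrite !sub0r scalerN opprK /GRing.scale/= mulr1.
have dF (x : R) : is_derive x (1 : R) F (g x).
  have dl : is_derive x (1 : R) (fun x => ln (1 + e x)) ((1 + e x)^-1 * (alpha * e x)).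
    apply: (@is_derive1_comp R (@ln R) (fun x => 1 + e x)).
      exact: is_derive1_ln.
    rewrite (_ : (fun _ => _) = cst 1 + e)//.
    by apply: is_derive_eq; rewrite add0r.
  rewrite (_ : F = (2 * M / alpha) *: (fun x => ln (1 + e x)))//.
  apply: is_derive_eq; rewrite /g /GRing.scale/=; field.
  by rewrite !lt0r_neq0.
have ce : continuous e.
  by move=> x; apply: differentiable_continuous; apply/derivable1_diffP; have [] := de x.
have cg : continuous g.
  move=> x; apply: cvgM; first exact: cvg_cst.
  apply: cvgM; first exact: ce.
  apply: cvgV; first by rewrite lt0r_neq0.
  by apply: cvgD; [exact: cvg_cst|exact: ce].
apply: le_trans (integral_le_primitive ltr01 dF cg cf _) _.
  move=> x /fM[/andP[f0 fleM] fe]; rewrite f0/= /g mulrA ler_pdivlMr//.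
  rewrite mulrDr mulr1; have {}fe : f x <= M * e x := fe.
  have := ler_wpM2r (ltW (e0 x)) fleM; lra.
rewrite lee_fin /F -mulrBr ler_wpM2l//.
  by rewrite !mulr_ge0// invr_ge0 ltW.
have l0 : 0 <= ln (1 + e 0) by rewrite ln_ge0// lerDl ltW.
(* [1 + e^c <= 2 e^c <= e^(c + 1)] *)
have l1 : ln (1 + e 1) <= c + 1.
  rewrite -[leRHS]expRK ler_ln ?posrE// ?expR_gt0//.
  rewrite /e subrr mulr0 subr0 expRD.
  have ec : 1 <= expR c by rewrite -expR0 ler_expR.
  have e2 : 1 + 1 <= expR 1 :> R by exact: expR_ge1Dx.
  have := ler_wpM2l (expR_ge0 c) e2; lra.
lra.
Qed.

(** * Seminorms on row vectors *)

Definition seminorm (R : numDomainType) (V : lmodType R) (p : V -> R) : Prop :=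
  (forall v w, p (v + w) <= p v + p w) /\
  (forall c v, p (c *: v) = `|c| * p v).

Lemma seminorm0 (R : numDomainType) (V : lmodType R) (p : V -> R) :
  seminorm p -> p 0 = 0.
Proof. by case=> _ pZ; rewrite -(scale0r 0) pZ normr0 mul0r. Qed.

Lemma seminorm_ge0 (R : numDomainType) (V : lmodType R) (p : V -> R) :
  seminorm p -> forall v, 0 <= p v.
Proof.
move=> sp v; have [pD pZ] := sp; have := pD v (- v).
rewrite -scaleN1r pZ normrN1 mul1r scaleN1r subrr (seminorm0 sp).
by rewrite -mulr2n pmulrn_lge0.
Qed.

(** A seminorm is Lipschitz for the maximum norm, the constant being the sum of
its values on the canonical basis. *)
Lemma seminorm_rV_continuous (R : realType) (k : nat) (p : 'rV[R]_k -> R) :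
  seminorm p -> continuous p.
Proof.
move=> sp; have [pD pZ] := sp; have p0 := seminorm_ge0 sp.
pose C := \sum_(i < k) p (delta_mx 0 i).
have pC v : p v <= C * `|v|.
  rewrite {1}(row_sum_delta v).
  have psum : p (\sum_(i < k) v ord0 i *: delta_mx 0 i) <=
      \sum_(i < k) p (v ord0 i *: delta_mx 0 i).
    elim/big_rec2: _ => [|i y1 y2 _ IH]; first by rewrite (seminorm0 sp).
    by apply: le_trans (pD _ _) _; rewrite lerD2l.
  apply: le_trans psum _; rewrite mulr_suml; apply: ler_sum => i _.
  rewrite pZ mulrC ler_wpM2l//.
  rewrite [leRHS]/Num.norm/= mx_normrE.
  by apply/bigmax_geP; right; exists (ord0, i).
have C0 : 0 <= C by apply: sumr_ge0.
have pB v w : p v <= p w + C * `|v - w|.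
  by rewrite -lerBlDl; apply: le_trans (pC _); rewrite lerBlDl -{1}(subrK w v) addrC pD.
move=> v; apply/(@cvgrPdist_le R R^o 'rV[R]_k (nbhs v) (nbhs_filter v)) => e e0.
have C10 : 0 < C + 1 by rewrite ltr_wpDl.
apply: filterS (nbhsx_ballx v _ (divr_gt0 e0 C10)) => w.
rewrite -ball_normE/= => /ltW vw.
have Cvw : C * `|v - w| <= e.
  rewrite -[leRHS](divfK (lt0r_neq0 C10)) mulrC ler_pM//.
  by rewrite lerDl.
rewrite ler_norml; apply/andP; split.
  by have := pB w v; rewrite distrC; lra.
by have := pB v w; lra.
Qed.

(** By homogeneity it suffices to maximise [p / q] on the unit sphere, which is
compact.  The cross-multiplied form also covers [w = 0]. *)
Lemma seminorm_quotient_max (R : realType) (k : nat) (p q : 'rV[R]_k -> R)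
    (v0 : 'rV[R]_k) :
  seminorm p -> seminorm q -> (forall v, v != 0 -> 0 < q v) -> v0 != 0 ->
  exists2 v, v != 0 & forall w, p w * q v <= p v * q w.
Proof.
move=> sp sq q0 v00; have [_ pZ] := sp; have [_ qZ] := sq.
have pc := seminorm_rV_continuous sp.
have qc := seminorm_rV_continuous sq.
pose S : set 'rV[R]_k := [set v | `|v| = 1]%classic.
have unitS (w : 'rV[R]_k) : w != 0 -> S (`|w|^-1 *: w).
  move=> w0; rewrite /S/= normrZ normfV normr_id mulVf// normr_eq0//.
have S0 v : S v -> v != 0.
  by rewrite /S/=; apply: contra_eq_neq => ->; rewrite normr0 eq_sym oner_eq0.
have cS : compact S.
  apply: bounded_closed_compact.
    by exists 1; split => // x x1 v; rewrite /S/= => ->; exact: ltW.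
  rewrite (_ : S = (fun v : 'rV[R]_k => `|v|) @^-1` [set 1])%classic//.
  by apply: closed_comp => [v _|]; [exact: (@norm_continuous R 'rV[R]_k)|exact: closed_eq].
have [||c] := @EVT_max_rV R k (fun v => p v / q v) S _ cS.
- by exists (`|v0|^-1 *: v0); exact: unitS.
- apply: continuous_in_subspaceT => v /[!inE] /S0 v1.
  apply: (@cvgM _ _ _ (nbhs_filter v)); first exact: pc.
  by apply: (@cvgV _ _ _ (nbhs_filter v)); [rewrite lt0r_neq0// q0|exact: qc].
rewrite inE => /S0 c0 cmax; exists c => // w.
have [->|w0] := eqVneq w 0; first by rewrite (seminorm0 sp) (seminorm0 sq) mul0r mulr0.
have := cmax (`|w|^-1 *: w); rewrite inE => /(_ (unitS _ w0)).
rewrite pZ qZ invfM mulrACA mulfV ?mul1r; last first.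
  by rewrite normr_eq0 invr_eq0 normr_eq0.
by rewrite ler_pdivrMr ?q0// mulrAC ler_pdivlMr ?q0.
Qed.

(** * A polynomial with nearly constant derivative near 1 *)

Definition bernstein (R : comNzRingType) (N j : nat) : {poly R} :=
  'C(N, j)%:R *: ('X^j * (1 - 'X) ^+ (N - j)).

Lemma deriv_bernstein (R : comNzRingType) (N j : nat) :
  (bernstein R N.+1 j.+1)^`() =
  N.+1%:R *: (bernstein R N j - bernstein R N j.+1).
Proof.
have E1 : N.+1%:R * 'C(N, j)%:R = j.+1%:R * 'C(N.+1, j.+1)%:R :> R.
  by rewrite -!natrM mul_bin_diag.
have E2 : N.+1%:R * 'C(N, j.+1)%:R = (N - j)%:R * 'C(N.+1, j.+1)%:R :> R.
  by rewrite -!natrM mul_bin_down subSS.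
have dX : (1 - 'X : {poly R})^`() = -1 by rewrite derivB derivX derivC sub0r.
rewrite /bernstein scalerBr !scalerA E1 E2 subSS derivZ derivM derivXn.
(* opaque, so that the integer factors below are the only ones to move *)
clear E1 E2; move: ('C(N.+1, j.+1)%:R : R) => c.
rewrite deriv_exp dX mulN1r mulNrn mulrN mulrnAr mulrnAl scalerBr.
by rewrite -!scalerMnr ![_ * c]mulrC -!scalerA !scaler_nat !scalerMnr subnS.
Qed.

Lemma horner_bernstein (R : comNzRingType) (N j : nat) (x : R) :
  (bernstein R N j).[x] = 'C(N, j)%:R * (x ^+ j * (1 - x) ^+ (N - j)).
Proof. by rewrite hornerZ hornerM horner_exp !hornerE. Qed.

Lemma sum_bernstein (R : comNzRingType) (N : nat) (x : R) :
  \sum_(j < N.+1) (bernstein R N j).[x] = 1.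
Proof.
rewrite -[RHS](expr1n _ N) -[in RHS](subrK x 1) exprDn; apply: eq_bigr => j _.
by rewrite horner_bernstein -[RHS]mulr_natl [x ^+ j * _]mulrC.
Qed.

Lemma bernstein_ge0 (R : numDomainType) (N j : nat) (x : R) :
  0 <= x <= 1 -> 0 <= (bernstein R N j).[x].
Proof.
move=> /andP[x0 x1]; rewrite horner_bernstein.
by rewrite mulr_ge0// mulr_ge0// exprn_ge0// subr_ge0.
Qed.

(** Turns the derivative of a linear ramp of Bernstein coefficients into a plain
sum. *)
Lemma sum_by_parts (V : zmodType) (b : nat -> V) (l : nat) :
  \sum_(i < l) (b i - b i.+1) *+ i.+1 = \sum_(i < l) b i - b l *+ l.
Proof.
elim: l => [|l IH]; first by rewrite !big_ord0 mulr0n subr0.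
by rewrite !big_ord_recr/= IH mulrnBl (mulrSr (b l)) !addrA subrK.
Qed.

(** The polynomial of degree [n + k] whose Bernstein coefficients are
[max (j - n, 0) / (n + k)]; only the nonzero ones are summed. *)
Definition bernstein_ramp (R : realType) (n k : nat) : {poly R} :=
  \sum_(i < k) (i.+1%:R / (n + k)%:R) *: bernstein R (n + k) (n + i.+1).

Lemma deriv_bernstein_ramp (R : realType) (n k : nat) :
  (bernstein_ramp R n k.+1)^`() = \sum_(i < k.+1) bernstein R (n + k) (n + i).
Proof.
rewrite /bernstein_ramp raddf_sum/=.
rewrite (eq_bigr (fun i : 'I_k.+1 => (bernstein R (n + k) (n + i)
  - bernstein R (n + k) (n + i.+1)) *+ i.+1)); last first.
  move=> i _; rewrite derivZ !addnS deriv_bernstein scalerA divfK ?pnatr_eq0//.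
  by rewrite scaler_nat.
rewrite (sum_by_parts (fun i => bernstein R (n + k) (n + i))).
by rewrite /bernstein bin_small ?ltn_add2l// scale0r mul0rn subr0.
Qed.

(** A partial sum of the partition of unity given by the Bernstein basis. *)
Lemma deriv_bernstein_ramp_bound (R : realType) (n k : nat) (x : R) :
  (0 < k)%N -> 0 <= x <= 1 -> `|(bernstein_ramp R n k)^`().[x]| <= 1.
Proof.
case: k => // k _ x01; rewrite deriv_bernstein_ramp horner_sum.
rewrite ger0_norm ?sumr_ge0// => [|i _]; last exact: bernstein_ge0.
rewrite -(sum_bernstein (n + k) x) -addnS big_split_ord/= lerDr.
by apply: sumr_ge0 => i _; exact: bernstein_ge0.
Qed.

Lemma bernstein_ramp1 (R : realType) (n k : nat) :
  (0 < k)%N -> (bernstein_ramp R n k).[1] = k%:R / (n + k)%:R.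
Proof.
case: k => // k _; rewrite horner_sum big_ord_recr/= big1 => [|i _].
  by rewrite add0r hornerZ horner_bernstein subnn binn expr1n expr0 !mulr1.
rewrite hornerZ horner_bernstein subrr expr0n subn_eq0 leq_add2l ltnS.
by rewrite leqNgt ltn_ord !mulr0.
Qed.

Lemma bernstein_ramp_Pnk (R : realType) (n k : nat) :
  (0 < k)%N -> Pnk n k (bernstein_ramp R n k).
Proof.
move=> k0.
pose S : {poly R} := \sum_(i < k) (i.+1%:R / (n + k)%:R * 'C(n + k, n + i.+1)%:R)
   *: ('X^i * (1 - 'X) ^+ (k - i.+1)).
have PS : bernstein_ramp R n k = 'X^(n.+1) * S.
  rewrite /bernstein_ramp /S mulr_sumr; apply: eq_bigr => i _.
  by rewrite /bernstein scalerA -scalerAr mulrA -exprD addSnnS subnDl.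
exists S; split => //.
- apply/eqP => S0; have := bernstein_ramp1 R n k0.
  rewrite PS S0 mulr0 horner0 => /esym/eqP.
  by rewrite mulf_eq0 invr_eq0 !pnatr_eq0 addn_eq0 (gtn_eqF k0) andbF.
- apply: (leq_trans (size_sum _ _ _)); apply/bigmax_leqP => i _.
  apply: leq_trans (size_scale_leq _ _) _.
  apply: leq_trans (size_polyMleq _ _) _; rewrite size_polyXn.
  have s1 : (size ((1 - 'X)%R : {poly R}) <= 2)%N.
    by rewrite -opprB size_polyN size_XsubC.
  have sexp : (size ((1 - 'X : {poly R}) ^+ (k - i.+1))%R <= (k - i.+1).+1)%N.
    apply: leq_trans (size_poly_exp_leq _ _) _; rewrite ltnS.
    by rewrite -[leqRHS]mul1n leq_mul// -subn1 leq_subLR.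
  by rewrite addSn/= (leq_trans (leq_add (leqnn _) sexp))// addnS -addSn subnKC.
Qed.

(** * Derivative norm, variation and minimal quotients *)

(** Real-valued; [deriv_supnorm_attained] shows that [fine] loses nothing. *)
Definition deriv_supnorm (R : realType) (P : {poly R}) : R :=
  fine (supnorm `[0, 1]%classic (horner P^`())).

Definition variation01 (R : realType) (P : {poly R}) : R :=
  (\int[lebesgue_measure]_(x in `[0%R, 1%R]%classic) `|P^`().[x]|)%R.

Lemma deriv_supnorm_attained (R : realType) (P : {poly R}) :
  exists x0, [/\ 0 <= x0 <= 1,
    supnorm `[0, 1]%classic (horner P)^`()%classic = (deriv_supnorm P)%:E,
    deriv_supnorm P = `|P^`().[x0]| &
    forall x, 0 <= x <= 1 -> `|P^`().[x]| <= deriv_supnorm P].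
Proof.
have cP : {within `[0, 1]%classic, continuous (fun x => `|P^`().[x]|)}%classic.
  apply: continuous_subspaceT => x.
  by apply: continuous_comp; [exact: continuous_horner|exact: norm_continuous].
have [x0 x01 xmax] := EVT_max ler01 cP.
have supE : supnorm `[0, 1]%classic (horner P^`()) = `|P^`().[x0]|%:E.
  apply/eqP; rewrite eq_le; apply/andP; split.
    apply: ge_ereal_sup => _ [x /= x1 <-]; rewrite lee_fin; exact: xmax.
  by apply: ereal_sup_ubound; exists x0.
have NE : deriv_supnorm P = `|P^`().[x0]| by rewrite /deriv_supnorm supE.
exists x0; split; [by move: x01; rewrite in_itv| |exact: NE|].
- by rewrite -derivE supE NE.
- by move=> x x1; rewrite NE; apply: xmax; rewrite in_itv.
Qed.

Lemma deriv_supnorm_seminorm (R : realType) : seminorm (@deriv_supnorm R).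
Proof.
split=> [P Q|c P].
  have [x [x01 _ -> _]] := deriv_supnorm_attained (P + Q).
  have [_ [_ _ _ leP]] := deriv_supnorm_attained P.
  have [_ [_ _ _ leQ]] := deriv_supnorm_attained Q.
  by rewrite derivD hornerD (le_trans (ler_normD _ _))// lerD ?leP ?leQ.
have [x [x01 _ Ex lex]] := deriv_supnorm_attained (c *: P).
have [y [y01 _ Ey ley]] := deriv_supnorm_attained P.
apply/eqP; rewrite eq_le; apply/andP; split.
  by rewrite Ex derivZ hornerZ normrM ler_wpM2l// ley.
by rewrite Ey -normrM -hornerZ -derivZ lex.
Qed.

Lemma poly_eq0_on_itv01 (R : numFieldType) (P : {poly R}) :
  (forall x, 0 <= x <= 1 -> P.[x] = 0) -> P = 0.
Proof.
move=> P0; pose s : seq R := [seq (i.+1%:R)^-1 | i <- iota 0 (size P)].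
(* more roots [1, 1/2, 1/3, ...] than the degree allows *)
apply: (@roots_geq_poly_eq0 _ P s).
- apply/allP => _ /mapP[i _ ->]; apply/rootP/P0.
  by rewrite invr_ge0 ler0n invf_le1 ?ltr0n// ler1n.
- rewrite map_inj_uniq ?iota_uniq// => i j /invr_inj/eqP.
  by rewrite eqr_nat eqSS => /eqP.
- by rewrite size_map size_iota.
Qed.

Lemma deriv_supnorm_gt0 (R : realType) (n k : nat) (P : {poly R}) :
  Pnk n k P -> 0 < deriv_supnorm P.
Proof.
move=> [S [S0 _ PE]].
have [x [_ _ Ex lex]] := deriv_supnorm_attained P.
rewrite lt_def {2}Ex normr_ge0 andbT; apply/eqP => N0.
have dP0 : P^`() = 0.
  apply: poly_eq0_on_itv01 => y /lex; rewrite N0 => yle.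
  by apply/eqP; rewrite -normr_le0.
have := polyorder.size_deriv P; rewrite dP0 size_poly0 PE mulrC size_Mmonic ?monicXn// size_polyXn.
by rewrite !addnS/= => /esym/eqP; rewrite addn_eq0 size_poly_eq0 (negbTE S0).
Qed.

Lemma integrable_norm_horner (R : realType) (Q : {poly R}) :
  lebesgue_measure.-integrable `[0%R, 1%R]%classic (EFin \o (fun x => `|Q.[x]|)).
Proof.
apply: continuous_compact_integrable; first exact: segment_compact.
apply: continuous_subspaceT => x.
by apply: continuous_comp; [exact: continuous_horner|exact: norm_continuous].
Qed.

Lemma C1_variationE (R : realType) (P : {poly R}) :
  C1_variation 0 1 (horner P) = (variation01 P)%:E.
Proof.
rewrite /C1_variation /variation01 /Rintegral fineK -?derivE//.
by apply: integrable_fin_num => //; exact: integrable_norm_horner.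
Qed.

Lemma variation01_seminorm (R : realType) : seminorm (@variation01 R).
Proof.
split=> [P Q|c P]; rewrite /variation01.
  rewrite derivD -RintegralD//; try exact: integrable_norm_horner.
  apply: le_Rintegral => //; first exact: integrable_norm_horner.
    rewrite (_ : _ \o _ = ((EFin \o (fun x => `|P^`().[x]|%R)) \+
       (EFin \o (fun x => `|Q^`().[x]|%R)))%E)//.
    by apply: integrableD => //; exact: integrable_norm_horner.
  by move=> x _; rewrite hornerD ler_normD.
rewrite -RintegralZl//; last exact: integrable_norm_horner.
by apply: eq_Rintegral => x _; rewrite derivZ hornerZ normrM.
Qed.

Lemma integral_deriv_poly (R : realType) (P : {poly R}) :
  (\int[lebesgue_measure]_(x in `[0%R, 1%R]) (P^`().[x])%:E
    = (P.[1] - P.[0])%:E)%E.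
Proof.
apply: (@integral_derivative R (horner P) (horner P^`())) => //.
exact: continuous_horner.
Qed.

Lemma endpoint_le_variation (R : realType) (n k : nat) (P : {poly R}) :
  Pnk n k P -> `|P.[1]| <= variation01 P.
Proof.
move=> [S [_ _ PE]].
have P0 : P.[0] = 0 by rewrite PE hornerM hornerXn expr0n mul0r.
rewrite -lee_fin -C1_variationE /C1_variation -derivE.
rewrite -[P.[1]]subr0 -[X in _ - X]P0 -abse_EFin -integral_deriv_poly.
apply: le_abse_integral => //.
apply/measurable_EFinP/measurable_funTS.
by apply: continuous_measurable_fun; exact: continuous_horner.
Qed.

Lemma deriv_Pnk (R : realType) (n k : nat) (P : {poly R}) :
  Pnk n k P -> exists2 Q : {poly R}, (size Q <= k)%N & P^`() = 'X^n * Q.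
Proof.
move=> [S [S0 sS ->]]; exists (n.+1%:R *: S + 'X * S^`()).
  apply: leq_trans (size_polyD _ _) _; rewrite geq_max.
  rewrite (leq_trans (size_scale_leq _ _) sS)/=.
  apply: leq_trans (size_polyMleq _ _) _; rewrite size_polyX addSn/= add1n.
  exact: leq_trans (lt_size_deriv S0) sS.
rewrite derivM derivXn/= mulrDr scaler_nat mulrnAl mulrnAr; congr (_ + _).
by rewrite mulrA -exprSr.
Qed.

(** The decay rate is [alpha = 2 n / 3] with [c = 4 m], so the integral is at
most [(3 / n) (4 m + 1) ||P'||], and [3 (4 m + 1) <= 12 (m + 1) = 12 k]. *)
Lemma variation_le_deriv_supnorm (R : realType) (n k : nat) (P : {poly R}) :
  (0 < n)%N -> (0 < k)%N -> Pnk n k P ->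
  n%:R * variation01 P <= 12 * k%:R * deriv_supnorm P.
Proof.
move=> n0; case: k => // m _ Pm.
have [Q sQ dP] := deriv_Pnk Pm.
have [_ [_ _ _ leN]] := deriv_supnorm_attained P.
have N0 := ltW (deriv_supnorm_gt0 Pm).
have dPx x : P^`().[x] = x ^+ n * Q.[x] by rewrite dP hornerM hornerXn.
have nn0 : (0 < n%:R :> R) by rewrite ltr0n.
have decay : forall x, 0 <= x <= 1 -> `|P^`().[x]| <=
    deriv_supnorm P * expR (4 * m%:R - 2 * n%:R / 3 * (1 - x)).
  move=> x x01; rewrite dPx; apply: weighted_poly_decay => // y y01.
  by rewrite -dPx leN.
have : ((variation01 P)%:E <=
    (2 * deriv_supnorm P / (2 * n%:R / 3) * (4 * m%:R + 1))%:E)%E.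
  rewrite -C1_variationE /C1_variation -derivE.
  apply: (@integral_decay_bound R (fun x => `|P^`().[x]|)) => //.
  - by rewrite divr_gt0// mulr_gt0.
  - move=> x; apply: continuous_comp; [exact: continuous_horner|exact: norm_continuous].
  - by move=> x x01; rewrite normr_ge0 leN// decay.
rewrite lee_fin => /(ler_wpM2l (ltW nn0))/le_trans; apply.
have -> : n%:R * (2 * deriv_supnorm P / (2 * n%:R / 3) * (4 * m%:R + 1))
   = 3 * (4 * m%:R + 1) * deriv_supnorm P by field; rewrite lt0r_neq0.
by rewrite ler_wpM2r// -natr1; lra.
Qed.

(** Coefficient vectors of [S] in [P = x^(n+1) S] carry the problem to row
vectors.  [P0] makes the maximal quotient [F P / ||P'||] positive. *)
Lemma quotient_min (R : realType) (n k : nat) (F : {poly R} -> R)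
    (P0 : {poly R}) :
  seminorm F -> Pnk n k P0 -> 0 < F P0 ->
  exists P, [/\ Pnk n k P, 0 < F P &
    forall Q, Pnk n k Q -> F Q * deriv_supnorm P <= F P * deriv_supnorm Q].
Proof.
move=> [FD FZ] PP0 FP0.
pose pol (v : 'rV[R]_k) : {poly R} := 'X^(n.+1) * rVpoly v.
have polD v w : pol (v + w) = pol v + pol w by rewrite /pol raddfD mulrDr.
have polZ c v : pol (c *: v) = c *: pol v by rewrite /pol linearZ -scalerAr.
have pol_Pnk v : v != 0 -> Pnk n k (pol v).
  move=> v0; exists (rVpoly v); split => //; last exact: size_poly.
  by apply: contra_neq v0 => v0; rewrite -[v]rVpolyK v0 raddf0.
have Pnk_pol P : Pnk n k P -> exists2 v, v != 0 & P = pol v.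
  move=> [S [S0 sS ->]]; exists (poly_rV S); last by rewrite /pol poly_rV_K.
  by apply: contra_neq S0 => vS; rewrite -(poly_rV_K sS) vS raddf0.
have [v0 v00 P0E] := Pnk_pol _ PP0.
have [ND NZ] := deriv_supnorm_seminorm R.
have sF : seminorm (F \o pol).
  by split=> [v w|c v] /=; [rewrite polD FD|rewrite polZ FZ].
have sN : seminorm (@deriv_supnorm R \o pol).
  by split=> [v w|c v] /=; [rewrite polD ND|rewrite polZ NZ].
have [|v vn0 vmax] := seminorm_quotient_max sF sN _ v00.
  by move=> v /pol_Pnk /deriv_supnorm_gt0.
have Pv := pol_Pnk _ vn0.
exists (pol v); split => //; last by move=> Q /Pnk_pol[w _ ->]; exact: vmax.
have := vmax v0; rewrite /= -P0E => le0.
have : 0 < F P0 * deriv_supnorm (pol v).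
  by rewrite mulr_gt0// (@deriv_supnorm_gt0 _ n k).
by move=> /lt_le_trans/(_ le0); rewrite pmulr_lgt0// (@deriv_supnorm_gt0 _ n k).
Qed.

(** The members with [F Q = 0] have the ratio [+oo], hence do not affect the
minimum. *)
Lemma is_min_over_quotient (R : realType) (n k : nat) (F : {poly R} -> R)
    (ratio : {poly R} -> \bar R) (P : {poly R}) :
  (forall Q, ratio Q = ((deriv_supnorm Q)%:E / (F Q)%:E)%E) ->
  (forall Q, 0 <= F Q) -> Pnk n k P -> 0 < F P ->
  (forall Q, Pnk n k Q -> F Q * deriv_supnorm P <= F P * deriv_supnorm Q) ->
  is_min_over (Pnk n k) ratio (deriv_supnorm P / F P)%:E.
Proof.
move=> ratioE F0 PP FP Pmin; split.
  by exists P => //; rewrite ratioE inver gt_eqF.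
move=> _ [Q QP <-]; rewrite ratioE inver; have NQ := deriv_supnorm_gt0 QP.
case: ifPn => [_|FQ0]; first by rewrite gt0_muley ?lte_fin// leey.
have FQ : 0 < F Q by rewrite lt_def FQ0 F0.
by rewrite -EFinM lee_fin ler_pdivrMr// mulrAC ler_pdivlMr// mulrC (mulrC _ (F P)) Pmin.
Qed.

Theorem theorem2p1 (R : realType) :
  exists c1 c2 : R,
    [/\ c1 = 1 / 12, 0 < c1, 0 < c2 &
      forall n k : nat, (1 <= n)%N -> (1 <= k)%N ->
        exists m1 m2 : \bar R,
          [/\ is_min_over (@Pnk R n k) (@derivative_variation_ratio R) m1,
              is_min_over (@Pnk R n k) (@derivative_endpoint_ratio R) m2,
              ((c1 * (n%:R / k%:R))%:E <= m1)%E,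
              (m1 <= m2)%E &
              (m2 <= (c2 * (n%:R / k%:R + 1))%:E)%E]].
Proof.
exists (1 / 12), 1; split => //.
move=> n k n1 k1.
have supE (Q : {poly R}) : supnorm `[0, 1]%classic (horner Q)^`()%classic
   = (deriv_supnorm Q)%:E by have [? []] := deriv_supnorm_attained Q.
have k0 : (0 < k%:R :> R) by rewrite ltr0n.
have n0 : (0 < n%:R :> R) by rewrite ltr0n.
pose end1 (Q : {poly R}) := `|Q.[1]|.
have send1 : seminorm end1.
  by split=> [P Q|c P]; rewrite /end1; [rewrite hornerD ler_normD|rewrite hornerZ normrM].
pose B := bernstein_ramp R n k.
have BP : Pnk n k B by exact: bernstein_ramp_Pnk.
have B1 : end1 B = k%:R / (n%:R + k%:R).
  by rewrite /end1 bernstein_ramp1// natrD ger0_norm// divr_ge0// addr_ge0.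
have B1_gt0 : 0 < end1 B by rewrite B1 divr_gt0// addr_gt0.
have NB : deriv_supnorm B <= 1.
  have [x [x01 _ -> _]] := deriv_supnorm_attained B.
  exact: deriv_bernstein_ramp_bound.
have VB_gt0 : 0 < variation01 B.
  exact: lt_le_trans B1_gt0 (endpoint_le_variation BP).
have [P1 [P1P V1 min1]] := quotient_min (variation01_seminorm R) BP VB_gt0.
have [P2 [P2P E2 min2]] := quotient_min send1 BP B1_gt0.
exists (deriv_supnorm P1 / variation01 P1)%:E, (deriv_supnorm P2 / end1 P2)%:E.
split.
- apply: is_min_over_quotient => // [Q|Q].
    by rewrite /derivative_variation_ratio supE C1_variationE.
  by apply: Rintegral_ge0 => x _; exact: normr_ge0.
- apply: is_min_over_quotient => // Q.
    by rewrite /derivative_endpoint_ratio supE.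
  exact: normr_ge0.
- rewrite lee_fin ler_pdivlMr//.
  have le12 := variation_le_deriv_supnorm n1 k1 P1P.
  have -> : 1 / 12 * (n%:R / k%:R) * variation01 P1 =
     n%:R * variation01 P1 / (12 * k%:R) by field; rewrite lt0r_neq0.
  by rewrite ler_pdivrMr ?mulr_gt0// [leRHS]mulrC.
- have N2 := deriv_supnorm_gt0 P2P.
  have V2 := endpoint_le_variation P2P.
  rewrite lee_fin ler_pdivrMr// mulrAC ler_pdivlMr// mulrC [leRHS]mulrC.
  apply: le_trans (min1 _ P2P); rewrite ler_wpM2r//.
  by rewrite ltW// (@deriv_supnorm_gt0 _ n k).
- rewrite lee_fin mul1r ler_pdivrMr//.
  have := min2 _ BP; rewrite B1 => minB.
  have -> : n%:R / k%:R + 1 = (k%:R / (n%:R + k%:R))^-1 :> R.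
    by rewrite invf_div; field; rewrite lt0r_neq0.
  rewrite mulrC ler_pdivlMr -?B1// B1 mulrC; apply: le_trans minB _.
  by rewrite ler_piMr// ltW.
Qed.
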